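(* Let $\mathcal{H}$ be a separable infinite-dimensional complex Hilbert space. Let $T\in\mathcal{B}(\mathcal{H})$ be a singular positive operator with closed range, with canonical form $T=U_1(A_1\oplus 0)U_1^*$, let $R$ be the unique positive solution of $R^2=A_1$, and let $R^\dagger=R^{-1}\oplus 0$. Let $A\in\mathcal{B}(\mathcal{H})$ be singular with closed range, let $b\in\mathcal{H}$, and suppose the set $S=\{x\in\mathcal{N}(T)^\perp: Ax=b\}$ is not empty. Assume that $P_{A^*}P_T$ has closed range. Then the problem of minimizing $\langle x,Tx\rangle$ over $x\in S$ has the unique solution $$\hat{x}=U_1R^\dagger(AU_1R^\dagger)^\dagger b.$$
   Context: $\mathcal{B}(\mathcal{H})$ denotes the bounded linear operators on $\mathcal{H}$; $\mathcal{N}(\cdot)$ and $\mathcal{R}(\cdot)$ denote kernel and range. A self-adjoint operator $T\in\mathcal{B}(\mathcal{H})$ is positive if $\langle Tx,x\rangle\ge 0$ for all $x\in\mathcal{H}$. Singular means not invertible. $P_T$ and $P_{A^*}$ denote the orthogonal projections of $\mathcal{H}$ onto $\mathcal{R}(T)$ and $\mathcal{R}(A^* )$, respectively. Canonical form: since $T$ is self-adjoint with closed range, there exist Hilbert spaces $\mathcal{K}_1,\mathcal{L}_1$, a unitary $U_1\in\mathcal{B}(\mathcal{K}_1\oplus\mathcal{L}_1,\mathcal{H})$ and an isomorphism $A_1\in\mathcal{B}(\mathcal{K}_1)$ such that $T=U_1(A_1\oplus 0)U_1^*$ (for instance $\mathcal{K}_1=\mathcal{R}(T)$, $\mathcal{L}_1=\mathcal{N}(T)$,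 $U_1(x_1,x_2)=x_1+x_2$, $A_1=T|_{\mathcal{R}(T)}$). As $T$ is positive, so is $A_1$; $R\in\mathcal{B}(\mathcal{K}_1)$ is its positive square root, which is invertible. $R^\dagger$ denotes the operator $R^{-1}\oplus 0=\begin{bmatrix}R^{-1}&0\\0&0\end{bmatrix}$ on $\mathcal{K}_1\oplus\mathcal{L}_1$. For any bounded operator $B$ with closed range between Hilbert spaces, $B^\dagger$ denotes its generalized (Moore-Penrose) inverse, the unique bounded operator satisfying $BB^\dagger=(BB^\dagger)^*$, $B^\dagger B=(B^\dagger B)^*$, $BB^\dagger B=B$, $B^\dagger BB^\dagger=B^\dagger$. (Under the hypotheses the operator $AU_1R^\dagger$ has closed range, so its Moore-Penrose inverse exists as a bounded operator.) *)

(* Defs.v *)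
From HB Require Import structures.
From mathcomp Require Import all_boot all_order all_algebra.
From mathcomp Require Import ring.
From mathcomp Require Import sesquilinear complex.
From mathcomp Require Import all_classical all_reals.
From mathcomp Require Import topology tvs normedtype.

Set Implicit Arguments.
Unset Strict Implicit.
Unset Printing Implicit Defensive.

Import Order.TTheory GRing.Theory Num.Def Num.Theory.
Import numFieldNormedType.Exports.
Local Open Scope classical_set_scope.
Local Open Scope ring_scope.

(* The inner product is linear in its first argument. *)
HB.mixin Record CompleteNormedModule_isHilbert (R : realType) (H : Type)
    & CompleteNormedModule R[i] H := {
  inner : {dot H for (@Num.conj R[i])} ;
  inner_normE : forall x : H, inner x x = `|x| ^+ 2
}.

#[short(type="hilbertType")]
HB.structure Definition Hilbert (R : realType) :=
  {H of CompleteNormedModule_isHilbert R H & CompleteNormedModule R[i] H}.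

Notation "''[' x , y ]" := (inner x%R y%R) : ring_scope.

(* [K * L] itself carries the max norm, which does not come from an inner
   product; hence this copy with norm (|x1|^2 + |x2|^2)^(1/2). *)
Definition dsum (K L : Type) : Type := (K * L)%type.
Notation "K (+) L" := (dsum K L)
  (at level 50, left associativity) : type_scope.

Section DirectSum.
Context {R : realType} {K L : hilbertType R}.
Implicit Types u v : (K (+) L)%type.

HB.instance Definition _ := GRing.Lmodule.copy (K (+) L)%type (K * L)%type.

Definition dsum_inner u v : R[i] := '[u.1, v.1] + '[u.2, v.2].

Definition dsum_norm u : R[i] := sqrtC (`|u.1| ^+ 2 + `|u.2| ^+ 2).

Let dsum_norm_ge0 u : 0 <= dsum_norm u.
Proof. by rewrite sqrtC_ge0 addr_ge0 ?exprn_ge0. Qed.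

Let dsum_normK u : dsum_norm u ^+ 2 = `|u.1| ^+ 2 + `|u.2| ^+ 2.
Proof. exact: sqrtCK. Qed.

Let dsum_normD u v : dsum_norm (u + v) <= dsum_norm u + dsum_norm v.
Proof.
rewrite -(@ler_pXn2r _ 2) ?nnegrE ?addr_ge0 ?dsum_norm_ge0//.
rewrite sqrrD !dsum_normK /=.
set a := `|u.1|; set b := `|u.2|; set c := `|v.1|; set d := `|v.2|.
have [a0 b0 c0 d0] : [/\ 0 <= a, 0 <= b, 0 <= c & 0 <= d].
  by split; exact: normr_ge0.
have cs : a * c + b * d <= dsum_norm u * dsum_norm v.
  rewrite -(@ler_pXn2r _ 2) ?nnegrE ?addr_ge0 ?mulr_ge0 ?dsum_norm_ge0//.
  rewrite exprMn !dsum_normK -/a -/b -/c -/d -subr_ge0.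
  rewrite [leRHS](_ : _ = (a * d - b * c) ^+ 2).
    by apply: real_exprn_even_ge0; rewrite // rpredB// ger0_real ?mulr_ge0.
  by rewrite sqrrB sqrrD !exprMn !mulrDl !mulrDr; ring.
have le1 : `|u.1 + v.1| ^+ 2 <= (a + c) ^+ 2.
  by rewrite lerXn2r ?nnegrE ?addr_ge0// ler_normD.
have le2 : `|u.2 + v.2| ^+ 2 <= (b + d) ^+ 2.
  by rewrite lerXn2r ?nnegrE ?addr_ge0// ler_normD.
apply: (le_trans (lerD le1 le2)).
rewrite -subr_ge0; move: cs; rewrite -subr_ge0 => cs.
have -> : a ^+ 2 + b ^+ 2 + dsum_norm u * dsum_norm v *+ 2
    + (c ^+ 2 + d ^+ 2) - ((a + c) ^+ 2 + (b + d) ^+ 2)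
  = (dsum_norm u * dsum_norm v - (a * c + b * d)) *+ 2 by ring.
exact: mulrn_wge0.
Qed.

Let dsum_normZ (k : R[i]) u : dsum_norm (k *: u) = `|k| * dsum_norm u.
Proof.
apply/eqP; rewrite -(@eqrXn2 _ 2) ?mulr_ge0 ?dsum_norm_ge0//.
by rewrite exprMn !dsum_normK /= !normrZ !exprMn mulrDr.
Qed.

Let dsum_norm0_eq0 u : dsum_norm u = 0 -> u = 0.
Proof.
move=> u0; have /eqP := dsum_normK u; rewrite u0 expr0n/= eq_sym.
rewrite paddr_eq0 ?exprn_ge0// !sqrf_eq0 !normr_eq0.
by case: u {u0} => ? ? /= /andP[/eqP -> /eqP ->].
Qed.

HB.instance Definition _ := Lmodule_isNormed.Build R[i] (K (+) L)%type
  dsum_normD dsum_normZ dsum_norm0_eq0.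

Let le_fst u : `|u.1| <= `|u|.
Proof.
rewrite -(@ler_pXn2r _ 2) ?nnegrE// [leRHS]dsum_normK lerDl.
exact: exprn_ge0.
Qed.

Let le_snd u : `|u.2| <= `|u|.
Proof.
rewrite -(@ler_pXn2r _ 2) ?nnegrE// [leRHS]dsum_normK lerDr.
exact: exprn_ge0.
Qed.

Let le_dsum_norm u : `|u| <= `|u.1| + `|u.2|.
Proof.
rewrite -(@ler_pXn2r _ 2) ?nnegrE ?addr_ge0// [leLHS]dsum_normK sqrrD.
by rewrite addrAC lerDl mulrn_wge0// mulr_ge0.
Qed.

Let dsum_complete (F : set_system (K (+) L)%type) :
  ProperFilter F -> cauchy F -> cvg F.
Proof.
move=> FF /cauchy_ballP F_cauchy.
have /cauchy_cvg /cvg_ex[/= x1 Fx1] : cauchy (fst @ F : set_system K).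
  apply/cauchy_ballP => e e0; have [[P Q] [FP FQ] PQ] := F_cauchy e e0.
  exists (fst @` P, fst @` Q) => /=.
    by split; [apply: filterS FP | apply: filterS FQ] => u Pu; exists u.
  move=> [_ _] /= [[u Pu <-] [v Qv <-]]; have := PQ (u, v) (conj Pu Qv).
  rewrite -!ball_normE /=; apply: le_lt_trans; exact: (le_fst (u - v)).
have /cauchy_cvg /cvg_ex[/= x2 Fx2] : cauchy (snd @ F : set_system L).
  apply/cauchy_ballP => e e0; have [[P Q] [FP FQ] PQ] := F_cauchy e e0.
  exists (snd @` P, snd @` Q) => /=.
    by split; [apply: filterS FP | apply: filterS FQ] => u Pu; exists u.
  move=> [_ _] /= [[u Pu <-] [v Qv <-]]; have := PQ (u, v) (conj Pu Qv).
  rewrite -!ball_normE /=; apply: le_lt_trans; exact: (le_snd (u - v)).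
apply/cvg_ex; exists ((x1, x2) : (K (+) L)%type).
apply/cvgrPdist_lt => e e0; near=> u.
apply: le_lt_trans (le_dsum_norm _) _; rewrite [e]splitr ltrD//=.
  by near: u; move/cvgrPdist_lt: Fx1; apply; rewrite divr_gt0.
by near: u; move/cvgrPdist_lt: Fx2; apply; rewrite divr_gt0.
Unshelve. all: by end_near. Qed.

HB.instance Definition _ := Uniform_isComplete.Build (K (+) L)%type dsum_complete.

Let dsum_inner_bilinear :
  bilinear_for *%R (@Num.conj R[i] \; *%R) dsum_inner.
Proof.
split=> [v a u u'|u a v v']; rewrite /dsum_inner /=.
  by rewrite !linearPl /= mulrDr addrACA.
by rewrite !linearPr /= mulrDr addrACA.
Qed.

HB.instance Definition _ := bilinear_isBilinear.Build R[i] (K (+) L)%type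
  (K (+) L)%type R[i] *%R (@Num.conj R[i] \; *%R) dsum_inner
  dsum_inner_bilinear.

Let dsum_inner_herm u v :
  dsum_inner u v = (-1) ^+ false * (dsum_inner v u)^*.
Proof.
rewrite /dsum_inner (hermC (@inner R K) u.1) (hermC (@inner R L) u.2).
by rewrite !expr0 !mul1r -rmorphD.
Qed.

HB.instance Definition _ := isHermitianSesquilinear.Build R[i] (K (+) L)%type
  false (@Num.conj R[i]) dsum_inner dsum_inner_herm.

Let dsum_inner_normE u : dsum_inner u u = `|u| ^+ 2.
Proof. by rewrite /dsum_inner !inner_normE [RHS]dsum_normK. Qed.

Let dsum_inner_gt0 u : u != 0 -> 0 < dsum_inner u u.
Proof. by move=> u0; rewrite dsum_inner_normE exprn_gt0// normr_gt0. Qed.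

HB.instance Definition _ := isDotProduct.Build R[i] (K (+) L)%type
  dsum_inner dsum_inner_gt0.

HB.instance Definition _ := CompleteNormedModule_isHilbert.Build R (K (+) L)%type
  dsum_inner_normE.

End DirectSum.

Definition separable (T : topologicalType) : Prop :=
  exists2 D : set T, countable D & dense D.

Definition infinite_dimensional (F : fieldType) (V : lmodType F) : Prop :=
  ~ exists (n : nat) (e : 'I_n -> V),
      forall x, exists c : 'I_n -> F, x = \sum_(i < n) c i *: e i.

Section Operators.
Context {R : realType}.
Implicit Types H K : hilbertType R.

Definition kernel H K (f : H -> K) : set H := f @^-1` [set 0].

Definition orth_compl H (M : set H) : set H :=
  [set x | forall m, M m -> '[x, m] = 0].

(* For a bounded linear [f] the point [z] exists and is unique, by the Riesz
   representation theorem; the default value [0] is irrelevant. *)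
Definition adjoint H K (f : H -> K) (y : K) : H :=
  xget 0 [set z | forall x, '[f x, y] = '[x, z]].

(* For a closed subspace [M] the point [p] exists and is unique. *)
Definition orth_proj H (M : set H) (x : H) : H :=
  xget 0 [set p | M p /\ orth_compl M (x - p)].

Definition self_adjoint H (f : H -> H) : Prop := adjoint f = f.

(* In the order of [R[i]], [0 <= z] means that [z] is real and nonnegative. *)
Definition positive_op H (f : H -> H) : Prop :=
  self_adjoint f /\ forall x, 0 <= '[f x, x].

Definition unitary_op H K (f : H -> K) : Prop :=
  adjoint f \o f = id /\ f \o adjoint f = id.

Definition invertible_op H K (f : H -> K) : Prop :=
  exists2 g : {linear K -> H}, continuous g & cancel f g /\ cancel g f.

Definition singular_op H K (f : H -> K) : Prop := ~ invertible_op f.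

(* The library's [pinv_] is a set-theoretic inverse, not the Moore-Penrose
   one; it is the inverse function whenever [f] is bijective. *)
Definition inv_op H K (f : H -> K) : K -> H := 'pinv_(fun=> 0) [set: H] f.

Definition dsum_op H1 H2 K1 K2 (f : H1 -> K1) (g : H2 -> K2) :
  (H1 (+) H2)%type -> (K1 (+) K2)%type := fun u => (f u.1, g u.2).

Definition is_moore_penrose H K (f : H -> K) (g : {linear K -> H}) : Prop :=
  [/\ continuous g, self_adjoint (f \o g), self_adjoint (g \o f),
      f \o g \o f = f & g \o f \o g = g].

(* Values are compared in [R[i]], whose order is the usual one on real
   numbers. *)
Definition minimizers H (q : H -> R[i]) (S : set H) : set H :=
  [set x | S x /\ forall y, S y -> q x <= q y].

End Operators.

(* Main.v *)
Require Import Defs.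
From HB Require Import structures.
From mathcomp Require Import all_boot all_order all_algebra.
From mathcomp Require Import ring.
From mathcomp Require Import sesquilinear complex.
From mathcomp Require Import all_classical all_reals.
From mathcomp Require Import topology tvs normedtype sequences.

(** Write [C = A U1 R^dag].  In the coordinates of the canonical form,
    both [range T] and the orthogonal complement of [kernel T] are
    [U1 (K1 (+) 0)], and for [x] in this space the vector [u = (R1 x1, 0)],
    where [x = U1 (x1, 0)], satisfies [x = U1 R^dag u], [<x, T x> = |u|^2] and
    [C u = A x].  Dropping the second component of a vector [u] changes neither
    [C u] nor [R^dag u] and does not increase [|u|].  Minimizing [<x, T x>] over
    [S] thus amounts to solving [C u = b] with [|u|] least.  As [C^dag C] is
    self-adjoint and idempotent, every solution of [C u = b] satisfies
    [|u|^2 = |C^dag b|^2 + |u - C^dag b|^2], so [C^dag b] is the only solution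
    of least norm ([moore_penrose_least_norm]).

    What remains is the existence of a bounded [C^dag], that is, the closedness
    of [range C = A (range T)] and the fact that a bounded operator with closed
    range has a bounded Moore-Penrose inverse ([moore_penrose_exists]).  Both
    rest on one estimate: if [range A] is closed, then [A^*] is bounded below on
    [range A] ([adjoint_bounded_below]).  Its proof uses the uniform boundedness
    principle instead of the open mapping theorem: the vectors [w] of [range A]
    with [|A^* w| <= 1] form a weakly bounded set, because
    [<A x + q, w> = <x, A^* w>] for [q] orthogonal to [range A].  The estimate
    implies that [range A^*] is closed, hence equal to the orthogonal complement
    of [kernel A], and that [A] is bounded below on [range A^*].  Now
    [A (range T)] is the image under [A] of the range of [P_{A^*} P_T], a closed
    subset of [range A^*], and is therefore closed ([closed_image_proj]). *)

Set Implicit Arguments.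
Unset Strict Implicit.
Unset Printing Implicit Defensive.

Import Order.TTheory GRing.Theory Num.Def Num.Theory.
Import numFieldNormedType.Exports.
Local Open Scope classical_set_scope.
Local Open Scope ring_scope.

(** * Inner products *)

Section InnerProduct.
Context {R : realType} {H : hilbertType R}.
Implicit Types (x y z u v : H) (a : R[i]).

Lemma innerC x y : '[x, y] = ('[y, x])^*.
Proof. by rewrite (hermC (@inner R H) x) expr0 mul1r. Qed.

Lemma innerDl x y z : '[x + y, z] = '[x, z] + '[y, z].
Proof. exact: linearDl. Qed.

Lemma innerBl x y z : '[x - y, z] = '[x, z] - '[y, z].
Proof. exact: linearBl. Qed.

Lemma innerZl a x y : '[a *: x, y] = a * '[x, y].
Proof. exact: linearZl_LR. Qed.

Lemma innerDr x y z : '[x, y + z] = '[x, y] + '[x, z].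
Proof. exact: linearDr. Qed.

Lemma innerBr x y z : '[x, y - z] = '[x, y] - '[x, z].
Proof. exact: linearBr. Qed.

Lemma innerZr a x y : '[x, a *: y] = a^* * '[x, y].
Proof. exact: linearZr_LR. Qed.

Lemma inner0l x : '[0, x] = 0.
Proof. exact: linear0l. Qed.

Lemma inner0r x : '[x, 0] = 0.
Proof. exact: linear0r. Qed.

Lemma inner_eq0C x y : '[x, y] = 0 -> '[y, x] = 0.
Proof. by rewrite innerC => /eqP; rewrite conjC_eq0 => /eqP. Qed.

Lemma inner_eq0 x : '[x, x] = 0 -> x = 0.
Proof. by rewrite inner_normE => /eqP; rewrite sqrf_eq0 normr_eq0 => /eqP. Qed.

Lemma inner_ext y z : (forall x, '[x, y] = '[x, z]) -> y = z.
Proof.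
move=> yz; apply/subr0_eq/inner_eq0.
by rewrite innerBr yz subrr.
Qed.

Lemma normD_ortho x y : '[x, y] = 0 -> `|x + y| ^+ 2 = `|x| ^+ 2 + `|y| ^+ 2.
Proof. by move=> xy; rewrite -!inner_normE hnormDd. Qed.

Lemma parallelogram x y :
  `|x + y| ^+ 2 + `|x - y| ^+ 2 = (`|x| ^+ 2 + `|y| ^+ 2) *+ 2.
Proof.
by rewrite -!inner_normE dnormD dnormB; ring.
Qed.

(** Pythagoras for the component of [x] orthogonal to the line spanned by [y]:
    it yields the Cauchy-Schwarz inequality, and also the orthogonality of the
    residual in the projection theorem. *)
Lemma norm_sub_proj x y : y != 0 ->
  `|x - ('[x, y] / `|y| ^+ 2) *: y| ^+ 2
  = `|x| ^+ 2 - `|'[x, y]| ^+ 2 / `|y| ^+ 2.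
Proof.
move=> y0.
have nC : (`|y| ^+ 2)^* = `|y| ^+ 2 by rewrite conj_Creal// rpredX// normr_real.
rewrite -[LHS]inner_normE innerBl !innerBr !innerZl !innerZr !inner_normE.
rewrite (innerC y x) rmorphM fmorphV /= nC normCK.
by field; rewrite normr_eq0.
Qed.

Lemma cauchy_schwarz x y : `|'[x, y]| <= `|x| * `|y|.
Proof.
have [->|y0] := eqVneq y 0; first by rewrite inner0r !normr0 mulr0.
have n0 : 0 < `|y| ^+ 2 by rewrite exprn_gt0// normr_gt0.
rewrite -(@ler_pXn2r _ 2) ?nnegrE ?mulr_ge0// exprMn -ler_pdivrMr//.
by rewrite -subr_ge0 -norm_sub_proj ?exprn_ge0.
Qed.

End InnerProduct.

(** * Completeness *)

(** A Cantor intersection principle: if the nonempty sets [D e] decrease with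
    [e] and their diameters tend to [0], then some point lies in the closure of
    all of them. *)
Lemma shrinking_sets_point (R : realType) (H : hilbertType R)
    (D : R[i] -> set H) :
    (forall e : R[i], 0 < e -> D e !=set0) ->
    (forall e e' : R[i], 0 < e -> e <= e' -> D e `<=` D e') ->
    (forall e, 0 < e -> exists2 d, 0 < d &
       forall u v, D d u -> D d v -> `|u - v| < e) ->
  exists p, forall e d, 0 < e -> 0 < d -> exists2 u, D d u & `|p - u| < e.
Proof.
move=> D0 Dle Dsmall.
pose F := filter_from [set e : R[i] | 0 < e] D.
have FF : ProperFilter F.
  apply: filter_from_proper; last by move=> e; exact: D0.
  apply: filter_from_filter; first by exists 1 => /=.
  move=> e e' /= e0 e0'.
  have := @real_leP _ e e' (gtr0_real e0) (gtr0_real e0').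
  case=> [le|/ltW le]; [exists e|exists e'] => //=; rewrite subsetI; split=> //;
    exact: Dle.
have Fc : cauchy F.
  apply/cauchy_ballP => e e0; have [d d0 Dd] := Dsmall e e0.
  exists (D d, D d) => /=; first by split; exists d.
  by move=> [u v] /= [Du Dv]; rewrite -ball_normE /=; exact: Dd.
have /cvg_ex[/= p Fp] := @cauchy_cvg _ F FF Fc.
exists p => e d e0 d0.
have : F (ball p e `&` D d).
  by apply: filterI; [apply: Fp; exact: nbhsx_ballx|exists d].
by move/filter_ex => [u []]; rewrite -ball_normE => pu Du; exists u.
Qed.

Lemma closed_approx (R : realType) (H : hilbertType R) (M : set H) p : closed M ->
  (forall e, 0 < e -> exists2 u, M u & `|p - u| < e) -> M p.
Proof.
move=> Mc Mp; apply: Mc => B /nbhs_ballP[e /= e0 eB].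
have [u Mu pu] := Mp e e0; exists u; split=> //.
by apply: eB; rewrite -ball_normE.
Qed.

Lemma small_norm_eq0 (R : realType) (V : normedModType R[i]) (x : V) (C : R[i]) :
  0 <= C -> (forall e, 0 < e -> `|x| <= e * C) -> x = 0.
Proof.
move=> C0 small; apply/eqP/negPn/negP => x0.
have C1 : 0 < C + 1 by rewrite ltr_wpDl.
have n0 : 0 < `|x| by rewrite normr_gt0.
have := small _ (divr_gt0 n0 C1).
by rewrite mulrAC ler_pdivlMr// ler_pM2l// gerDl ler10.
Qed.

(** The approximate preimages of a point in the closure of [f @` D] are sets of
    diameter tending to [0]. *)
Lemma closed_image_bounded_below (R : realType) (H K : hilbertType R)
    (f : H -> K) (D : set H) (C : R[i]) :
    continuous f -> closed D -> 0 < C ->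
    (forall u v, D u -> D v -> `|u - v| <= C * `|f u - f v|) ->
  closed (f @` D).
Proof.
move=> fc Dc C0 fD y cy.
pose E (e : R[i]) := [set u | D u /\ `|y - f u| < e].
have Ene e : 0 < e -> E e !=set0.
  move=> e0; have [_ [[u Du <-]]] := cy _ (nbhsx_ballx y e e0).
  by rewrite -ball_normE => yu; exists u.
have Ele e e' : 0 < e -> e <= e' -> E e `<=` E e'.
  by move=> _ ee' u [Du lt]; split=> //; exact: lt_le_trans ee'.
have Esmall e : 0 < e -> exists2 d, 0 < d &
    forall u v, E d u -> E d v -> `|u - v| < e.
  move=> e0; have d0 : 0 < e / C / 2 by rewrite !divr_gt0.
  exists (e / C / 2) => // u v [Du yu] [Dv yv].
  rewrite (le_lt_trans (fD _ _ Du Dv))// mulrC -ltr_pdivlMr//.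
  by rewrite [ltRHS]splitr (le_lt_trans (ler_distD y _ _))// ltrD// distrC.
have [p pE] := shrinking_sets_point Ene Ele Esmall.
have Dp : D p.
  apply: closed_approx => // e e0.
  by have [u [Du _] pu] := pE e 1 e0 ltr01; exists u.
exists p => //; apply/esym/subr0_eq.
apply: (@small_norm_eq0 _ _ _ 2) => // e e0.
have /cvgrPdist_lt/(_ _ e0)/nbhs_ballP[d /= d0 dp] := fc p.
have [u [Du yu] pu] := pE d e d0 e0.
rewrite (le_trans (ler_distD (f u) _ _))// mulr_natr mulr2n lerD// ltW//.
by rewrite distrC; apply: dp; rewrite -ball_normE.
Qed.

(** * Orthogonal projections and the Riesz representation *)

Section Projection.
Context {R : realType} {H : hilbertType R}.
Implicit Types (x y : H) (M : set H).

(** A linear subspace, not necessarily closed. *)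
Definition is_subspace M : Prop :=
  M 0 /\ forall (a : R[i]) u v, M u -> M v -> M (a *: u + v).

Lemma subspaceD M u v : is_subspace M -> M u -> M v -> M (u + v).
Proof. by move=> [_ Ml] Mu Mv; rewrite -[u]scale1r; exact: Ml. Qed.

Lemma subspaceZ M (a : R[i]) u : is_subspace M -> M u -> M (a *: u).
Proof. by move=> [M0 Ml] Mu; rewrite -[_ *: _]addr0; exact: Ml. Qed.

Lemma subspaceB M u v : is_subspace M -> M u -> M v -> M (u - v).
Proof.
by move=> Ms Mu Mv; rewrite -scaleN1r; apply: subspaceD => //; exact: subspaceZ.
Qed.

Lemma ortho_self M x : M x -> orth_compl M x -> x = 0.
Proof. by move=> Mx /(_ x Mx)/inner_eq0. Qed.

Lemma orth_complB M u v :
  orth_compl M u -> orth_compl M v -> orth_compl M (u - v).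
Proof. by move=> Mu Mv m Mm; rewrite innerBl Mu// Mv// subrr. Qed.

(** [d] is the squared distance from [x] to [M].  It is the infimum of a set of
    reals, read in [R[i]], where the norm takes its values. *)
Lemma inf_sqr_dist M x : is_subspace M -> exists d : R[i],
  (forall m, M m -> d <= `|x - m| ^+ 2) /\
  (forall e : R[i], 0 < e -> exists2 m, M m & `|x - m| ^+ 2 < d + e).
Proof.
move=> [M0 _].
pose E : set R := [set r | exists2 m, M m & (r%:C)%C = `|x - m| ^+ 2].
have ReE m : ((complex.Re (`|x - m| ^+ 2))%:C)%C = `|x - m| ^+ 2 :> R[i].
  by rewrite RRe_real// ger0_real// exprn_ge0.
have Einf : has_inf E.
  split; first by exists (complex.Re (`|x - 0| ^+ 2)), 0.
  by exists 0 => r [m _ rE]; rewrite -lecR rE exprn_ge0.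
exists ((inf E)%:C)%C; split.
  move=> m Mm; rewrite -ReE lecR; apply: ge_inf; first by case: Einf.
  by exists m.
move=> e e0; have eE : ((complex.Re e)%:C)%C = e by rewrite RRe_real// gtr0_real.
have Re0 : 0 < complex.Re e by rewrite -ltcR eE.
have [r [m Mm rE] rlt] := inf_adherent Re0 Einf.
by exists m => //; rewrite -rE -eE -rmorphD ltcR.
Qed.

(** The projection theorem. *)
Lemma ortho_decomp M x : is_subspace M -> closed M ->
  exists2 p, M p & orth_compl M (x - p).
Proof.
move=> Ms Mc; have [d [dM Md]] := inf_sqr_dist x Ms.
pose D e := [set m | M m /\ `|x - m| ^+ 2 < d + e].
have Dne e : 0 < e -> D e !=set0 by move=> /Md[m Mm ?]; exists m.
have Dle e e' : 0 < e -> e <= e' -> D e `<=` D e'.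
  by move=> _ ee' m [Mm lt]; split=> //; rewrite (lt_le_trans lt)// lerD2l.
have Dsmall e : 0 < e -> exists2 r, 0 < r &
    forall u v, D r u -> D r v -> `|u - v| < e.
  (* The midpoint of [u] and [v] is no closer to [x] than [d] allows, so the
     parallelogram law bounds [`|u - v| ^+ 2] by four times the slack. *)
  move=> e0; exists (e ^+ 2 / 4); first by rewrite divr_gt0// exprn_gt0.
  move=> u v [Mu ud] [Mv vd].
  rewrite -(@ltr_pXn2r _ 2) ?nnegrE ?(ltW e0)//.
  have mid : M (2^-1 *: (u + v)) by apply: subspaceZ => //; exact: subspaceD.
  have := parallelogram (x - u) (x - v).
  have -> : (x - u) + (x - v) = (2 : R[i]) *: (x - 2^-1 *: (u + v)).
    rewrite scalerBr scalerA divff ?pnatr_eq0// scale1r scaler_nat mulr2n.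
    by rewrite opprD addrACA.
  have -> : (x - u) - (x - v) = v - u by rewrite opprB addrC addrA subrK.
  rewrite normrZ exprMn (distrC v) normr_nat => uvE.
  have -> : `|u - v| ^+ 2 = (`|x - u| ^+ 2 + `|x - v| ^+ 2) *+ 2
      - 2 ^+ 2 * `|x - 2^-1 *: (u + v)| ^+ 2.
    by rewrite -uvE addrAC subrr add0r.
  have -> : e ^+ 2 = ((d + e ^+ 2 / 4) + (d + e ^+ 2 / 4)) *+ 2 - 2 ^+ 2 * d.
    by field.
  by rewrite ltr_leB ?ltr_pMn2r ?ltrD// ler_wpM2l ?dM ?exprn_ge0.
have [p pD] := shrinking_sets_point Dne Dle Dsmall.
have Mp : M p.
  apply: closed_approx => // e e0.
  by have [u [Mu _] pu] := pD e 1 e0 ltr01; exists u.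
exists p => // m Mm.
have [->|m0] := eqVneq m 0; first by rewrite inner0r.
have n0 : 0 < `|m| ^+ 2 by rewrite exprn_gt0// normr_gt0.
apply: (@small_norm_eq0 R R[i]^o _ (`|m| *+ 2)); first by rewrite mulrn_wge0.
move=> e e0; have [u [Mu ud] pu] := pD e (e ^+ 2) e0 (exprn_gt0 2 e0).
have -> : '[x - p, m] = '[x - u, m] - '[p - u, m].
  by rewrite -innerBl opprB addrA subrK.
rewrite (le_trans (ler_normB _ _))// mulr2n mulrDr lerD//; last first.
  by rewrite (le_trans (cauchy_schwarz _ _))// ler_wpM2r// ltW.
rewrite -(@ler_pXn2r _ 2) ?nnegrE ?mulr_ge0 ?(ltW e0)// exprMn -ler_pdivrMr//.
(* Moving [u] along [m] cannot bring it closer to [x] than [d] allows. *)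
have := dM (u + ('[x - u, m] / `|m| ^+ 2) *: m).
rewrite opprD addrA norm_sub_proj// => /(_ _).
have Mt : M (u + ('[x - u, m] / `|m| ^+ 2) *: m).
  by apply: subspaceD => //; exact: subspaceZ.
move=> /(_ Mt); rewrite lerBrDr -lerBrDl => /le_trans; apply.
by rewrite lerBlDl ltW.
Qed.

End Projection.

Section Riesz.
Context {R : realType} {H : hilbertType R}.
Implicit Types (x y : H) (M : set H).

Lemma orth_projP M x : is_subspace M -> closed M ->
  M (orth_proj M x) /\ orth_compl M (x - orth_proj M x).
Proof.
move=> Ms Mc; have [p Mp xp] := ortho_decomp x Ms Mc.
have : exists p, [set p | M p /\ orth_compl M (x - p)] p by exists p.
exact: (xgetPex 0).
Qed.

Lemma orth_proj_id M x :
  is_subspace M -> closed M -> M x -> orth_proj M x = x.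
Proof.
move=> Ms Mc Mx; have [Mp xp] := orth_projP x Ms Mc.
by apply/esym/subr0_eq; apply: ortho_self xp; exact: subspaceB.
Qed.

(** The Riesz representation theorem. *)
Lemma riesz (f : H -> R[i]) (C : R[i]) : scalar f -> 0 <= C ->
  (forall x, `|f x| <= C * `|x|) -> exists z, forall x, f x = '[x, z].
Proof.
move=> fl C0 fC.
have [f0|] := pselect (forall x, f x = 0).
  by exists 0 => x; rewrite inner0r.
move=> /existsNP[x0 /eqP fx0].
have f00 : f 0 = 0 by have := fl (-1) 0 0; rewrite scaler0 addr0 mulN1r addNr.
have fB u v : f (u - v) = f u - f v.
  by rewrite addrC -scaleN1r fl mulN1r addrC.
have kc : closed (f @^-1` [set 0]).
  move=> u cu; apply: (@small_norm_eq0 R R[i]^o _ C) => // e e0.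
  have [v [/= fv uv]] := cu _ (nbhsx_ballx u e e0).
  rewrite -[f u]subr0 -fv -fB mulrC (le_trans (fC _))// ler_wpM2l// ltW//.
  by move: uv; rewrite -ball_normE.
have ks : is_subspace (f @^-1` [set 0]).
  by split=> // a u v /= fu fv; rewrite fl fu fv mulr0 addr0.
have [p /= fp] := ortho_decomp x0 ks kc.
set u := x0 - p => uo.
have fu : f u = f x0 by rewrite fB fp subr0.
have u0 : '[u, u] != 0.
  by apply: contra_neq fx0 => /inner_eq0 u0; rewrite -fu u0.
exists (((f u) / '[u, u])^* *: u) => x.
rewrite innerZr conjCK.
(* The vector [u] spans the orthogonal complement of the kernel of [f]. *)
have : f (x - (f x / f u) *: u) = 0.
  by rewrite fB -[_ *: u]addr0 fl f00 addr0 divfK ?subrr// fu.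
move=> /(uo _)/inner_eq0C; rewrite innerBl innerZl => /eqP; rewrite subr_eq0.
move=> /eqP ->; rewrite -fu in fx0; field.
by rewrite u0 fx0.
Qed.

End Riesz.

(** * Bounded operators and their adjoints *)

Lemma continuous_linearP (R : realType) (V W : normedModType R[i])
    (f : {linear V -> W}) :
  continuous f <-> exists2 C : R[i], 0 < C & forall x, `|f x| <= C * `|x|.
Proof.
rewrite -linear_bounded_continuous linear_boundedP.
split=> [/pinfty_ex_gt0[C C0 fC]|[C C0 fC]]; first by exists C.
exists C; split; first exact: gtr0_real.
by move=> r Cr x; rewrite (le_trans (fC x))// ler_wpM2r// ltW.
Qed.

Lemma range_subspace (R : realType) (H K : hilbertType R)
    (A : {linear H -> K}) : is_subspace (range A).
Proof.
split; first by exists 0; rewrite ?linear0.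
by move=> a _ _ [u _ <-] [v _ <-]; exists (a *: u + v); rewrite ?linearP.
Qed.

Section Adjoint.
Context {R : realType} {H K : hilbertType R}.
Implicit Types (x : H) (y : K) (A : {linear H -> K}).

Lemma adjointP A x y : continuous A -> '[A x, y] = '[x, adjoint A y].
Proof.
move=> /continuous_linearP[C C0 AC].
suff [z zP] : exists z, forall x, '[A x, y] = '[x, z].
  have : exists z, [set z | forall x, '[A x, y] = '[x, z]] z by exists z.
  by move/(xgetPex 0); apply.
apply: (@riesz _ _ (fun x => '[A x, y]) (C * `|y|)).
- by move=> a u v; rewrite linearP innerDl innerZl.
- by rewrite mulr_ge0// ltW.
- by move=> u; rewrite (le_trans (cauchy_schwarz _ _))// mulrAC ler_wpM2r.
Qed.

Lemma adjoint_eq (f : H -> K) (g : K -> H) :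
  (forall x y, '[f x, y] = '[x, g y]) -> adjoint f = g.
Proof.
move=> fg; apply/funext => y; apply: inner_ext => x; rewrite -fg.
have : exists z, [set z | forall x, '[f x, y] = '[x, z]] z by exists (g y).
by move/(xgetPex 0) => /= <-.
Qed.

Lemma adjoint_linear A : continuous A -> linear (adjoint A).
Proof.
move=> Ac a u v; apply: inner_ext => x.
by rewrite -adjointP// innerDr innerZr !adjointP// -innerZr -innerDr.
Qed.

Lemma adjointB A u v : continuous A ->
  adjoint A (u - v) = adjoint A u - adjoint A v.
Proof.
by move=> Ac; apply: inner_ext => x; rewrite -adjointP// !innerBr -!adjointP.
Qed.

Lemma adjointZ A (a : R[i]) w : continuous A ->
  adjoint A (a *: w) = a *: adjoint A w.
Proof.
by move=> Ac; apply: inner_ext => x; rewrite -adjointP// !innerZr -adjointP.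
Qed.

Lemma adjoint_continuous A : continuous A -> continuous (adjoint A).
Proof.
move=> Ac.
pose B : {linear K -> H} :=
  HB.pack (adjoint A) (GRing.isLinear.Build _ _ _ _ _ (adjoint_linear Ac)).
apply/(@continuous_linearP _ _ _ B).
have /continuous_linearP[C C0 AC] := Ac; exists C => // y /=.
have [->|n0] := eqVneq (adjoint A y) 0; first by rewrite normr0 mulr_ge0// ltW.
rewrite -(@ler_pM2l _ `|adjoint A y|) ?normr_gt0// -expr2 -inner_normE.
rewrite -adjointP// mulrCA mulrA (le_trans (real_ler_norm _))//.
  by rewrite adjointP// inner_normE rpredX// normr_real.
by rewrite (le_trans (cauchy_schwarz _ _))// ler_wpM2r.
Qed.

Lemma range_adjoint_subspace A : continuous A -> is_subspace (range (adjoint A)).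
Proof.
move=> Ac.
exact: (range_subspace (HB.pack (adjoint A)
  (GRing.isLinear.Build _ _ _ _ _ (adjoint_linear Ac)))).
Qed.

Lemma kernel_adjoint A x : continuous A ->
  A x = 0 <-> orth_compl (range (adjoint A)) x.
Proof.
move=> Ac; split=> [Ax0 _ [y _ <-]|xo]; first by rewrite -adjointP// Ax0 inner0l.
by apply: inner_eq0; rewrite adjointP// xo.
Qed.

Lemma cokernel_adjoint A y : continuous A ->
  orth_compl (range A) y <-> adjoint A y = 0.
Proof.
move=> Ac; split=> [yo|Ay0 _ [x _ <-]].
  by apply: inner_ext => x; rewrite -adjointP// inner0r; exact/inner_eq0C/yo.
by apply: inner_eq0C; rewrite adjointP// Ay0 inner0r.
Qed.

End Adjoint.

(** * Weakly bounded sets are bounded *)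

(** [H] as a complete normed space over [R], by restriction of scalars: the
    uniform boundedness principle is applied to real functionals on it.  The norm
    of [H] has values in [R[i]]; here it is read as a real number, [rnorm]. *)
Definition realified (R : realType) (H : hilbertType R) : Type := H.

Section Realified.
Context {R : realType} {H : hilbertType R}.
Local Notation HR := (realified H).
Local Open Scope complex_scope.

HB.instance Definition _ := GRing.Zmodule.copy HR H.

Let rscale (a : R) (x : HR) : HR := a%:C *: (x : H).

Let rscaleA a b x : rscale a (rscale b x) = rscale (a * b) x.
Proof. by rewrite /rscale scalerA -rmorphM. Qed.

Let rscale1 : left_id 1 rscale.
Proof. by move=> x; rewrite /rscale rmorph1 scale1r. Qed.

Let rscaleDr : right_distributive rscale +%R.
Proof. by move=> a x y; rewrite /rscale scalerDr. Qed.

Let rscaleDl x : {morph rscale^~ x : a b / a + b}.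
Proof. by move=> a b; rewrite /rscale rmorphD scalerDl. Qed.

HB.instance Definition _ := GRing.Zmodule_isLmodule.Build R HR
  rscaleA rscale1 rscaleDr rscaleDl.

Definition rnorm (x : HR) : R := complex.Re `|x : H|.

Lemma rnormE (x : HR) : (rnorm x)%:C = `|x : H|.
Proof. by rewrite /rnorm RRe_real// normr_real. Qed.

Let rnormD x y : rnorm (x + y) <= rnorm x + rnorm y.
Proof.
by rewrite -lecR rmorphD /= !rnormE; exact: (ler_normD (x : H) y).
Qed.

Let rnormZ (a : R) (x : HR) : rnorm (a *: x) = `|a| * rnorm x.
Proof.
apply: complexI; rewrite rmorphM /= !rnormE normrZ normc_def /=.
by rewrite expr0n addr0 sqrtr_sqr.
Qed.

Let rnorm_eq0 x : rnorm x = 0 -> x = 0.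
Proof. by move=> x0; apply/normr0_eq0; rewrite -rnormE x0. Qed.

HB.instance Definition _ := Lmodule_isNormed.Build R HR rnormD rnormZ rnorm_eq0.

Let rcomplete (F : set_system HR) : ProperFilter F -> cauchy F -> cvg F.
Proof.
move=> FF /cauchy_ballP Fc.
have /cauchy_cvg /cvg_ex[/= x Fx] : cauchy (F : set_system H).
  apply/cauchy_ballP => e e0.
  have eE : (complex.Re e)%:C = e by rewrite RRe_real// gtr0_real.
  have e0' : 0 < complex.Re e by rewrite -ltcR eE.
  apply: filterS (Fc _ e0') => -[u v]; rewrite -!ball_normE /=.
  by rewrite -ltcR eE => lt; apply: le_lt_trans lt; rewrite rnormE.
apply/cvg_ex; exists (x : HR); apply/cvgrPdist_lt => e e0.
have e0' : 0 < e%:C by rewrite ltcR.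
move/cvgrPdist_lt: Fx => /(_ _ e0'); apply: filterS => u.
by rewrite -rnormE ltcR.
Qed.

HB.instance Definition _ := Uniform_isComplete.Build HR rcomplete.

End Realified.

(** Uniform boundedness, applied to the real functionals [Re <., w>], [w] in
    [W].  The bound at [w / |w|] is a bound on [|w|]. *)
Lemma weakly_bounded (R : realType) (H : hilbertType R) (W : set H) :
  (forall x : H, exists C : R[i], forall w, W w -> `|'[x, w]| <= C) ->
  exists2 C : R[i], 0 < C & forall w, W w -> `|w| <= C.
Proof.
move=> Wb.
pose f (w : H) (x : realified H) : R^o := complex.Re '[x : H, w].
pose F := f @` W.
have Re_le (z : R[i]) : `|complex.Re z| <= complex.Re `|z|.
  rewrite -lecR RRe_real ?normr_real//; exact: normc_ge_Re.
have Ff g : F g -> bounded_fun_norm g /\ linear g.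
  move=> [w Ww <-]; split; last first.
    move=> a x y; rewrite /f innerDl innerZl.
    by case: '[_, _] => ? ?; case: '[_, _] => ? ?; rewrite /= mul0r subr0.
  move=> r; exists (r * complex.Re `|w|) => x xr; rewrite (le_trans (Re_le _))//.
  rewrite -lecR rmorphM /= !RRe_real ?normr_real//.
  by rewrite (le_trans (cauchy_schwarz _ _))// ler_wpM2r// -rnormE lecR.
have Fp : pointwise_bounded F.
  move=> x; have [C WC] := Wb x; exists (complex.Re C) => _ [w Ww <-].
  rewrite (le_trans (Re_le _))//; have := WC w Ww.
  by rewrite lecE => /andP[].
have [M MF] := Banach_Steinhauss Ff Fp 1.
exists (1 + `|M|)%:C%C; first by rewrite ltcR ltr_wpDr.
move=> w Ww.
have [->|w0] := eqVneq w 0; first by rewrite normr0 lecR addr_ge0.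
pose x : H := `|w|^-1 *: w.
have x1 : `|x : realified H| <= 1.
  by rewrite -lecR [leLHS]rnormE normrZ normfV normr_id mulVf ?normr_eq0.
have := MF (f w) (ex_intro2 _ _ w Ww erefl) x x1.
rewrite /f innerZl inner_normE expr2 mulKf ?normr_eq0// => le.
rewrite -[leLHS]RRe_real ?normr_real// lecR (le_trans (ler_norm _))//.
by rewrite (le_trans le)// (le_trans (ler_norm _))// lerDr.
Qed.

(** * Operators with closed range and the Moore-Penrose inverse *)

Section ClosedRange.
Context {R : realType} {H K : hilbertType R}.
Implicit Types (x z : H) (y w : K) (A : {linear H -> K}).

(** The vectors [w] of [range A] with [|A^* w| <= 1] form a weakly bounded
    set. *)
Lemma adjoint_bounded_below A : continuous A -> closed (range A) ->
  exists2 C : R[i], 0 < C &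
    forall w, range A w -> `|w| <= C * `|adjoint A w|.
Proof.
move=> Ac Aclosed; have As := range_subspace A.
pose W := [set w | range A w /\ `|adjoint A w| <= 1].
have [y|C C0 WC] := @weakly_bounded R K W.
  have [p [x _ xp] yp] := ortho_decomp y As Aclosed.
  exists `|x| => w [Aw w1].
  have -> : '[y, w] = '[x, adjoint A w].
    by rewrite -adjointP// xp; apply/eqP; rewrite -subr_eq0 -innerBl yp.
  by rewrite (le_trans (cauchy_schwarz _ _))// ler_piMr.
exists C => // w Aw; have [w0|n0] := eqVneq (adjoint A w) 0.
  by rewrite (ortho_self Aw) ?normr0 ?mulr_ge0 ?(ltW C0)//; exact/cokernel_adjoint.
have wn : 0 < `|adjoint A w| by rewrite normr_gt0.
have : W (`|adjoint A w|^-1 *: w).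
  split; first exact: subspaceZ.
  by rewrite adjointZ// normrZ normfV normr_id mulVf ?normr_eq0.
by move=> /WC; rewrite normrZ normfV normr_id ler_pdivrMl// mulrC.
Qed.

Lemma range_adjoint_closed A : continuous A -> closed (range A) ->
  closed (range (adjoint A)).
Proof.
move=> Ac Aclosed; have [C C0 AC] := adjoint_bounded_below Ac Aclosed.
have -> : range (adjoint A) = adjoint A @` range A.
  rewrite eqEsubset; split; last by move=> _ [w _ <-]; exists w.
  move=> _ [y _ <-]; have [w Aw yw] := ortho_decomp y (range_subspace A) Aclosed.
  exists w => //; apply/esym/subr0_eq; rewrite -adjointB//.
  exact/cokernel_adjoint.
apply: (closed_image_bounded_below (adjoint_continuous Ac) Aclosed C0).
move=> u v Au Av; rewrite -adjointB// AC//.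
by apply: subspaceB => //; exact: range_subspace.
Qed.

Lemma bounded_below_range_adjoint A : continuous A -> closed (range A) ->
  exists2 C : R[i], 0 < C &
    forall z, range (adjoint A) z -> `|z| <= C * `|A z|.
Proof.
move=> Ac Aclosed; have [C C0 AC] := adjoint_bounded_below Ac Aclosed.
exists C => // _ [y _ <-].
have [w Aw yw] := ortho_decomp y (range_subspace A) Aclosed.
have -> : adjoint A y = adjoint A w.
  apply/subr0_eq; rewrite -adjointB//; exact/cokernel_adjoint.
have [->|n0] := eqVneq (adjoint A w) 0.
  by rewrite normr0 mulr_ge0// ltW.
have zn : 0 < `|adjoint A w| by rewrite normr_gt0.
rewrite -(ler_pM2r zn) -expr2 -inner_normE -adjointP//.
have -> : '[A (adjoint A w), w] = `|'[A (adjoint A w), w]|.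
  by rewrite ger0_norm// adjointP// inner_normE exprn_ge0.
rewrite (le_trans (cauchy_schwarz _ _))//.
by rewrite -mulrA mulrCA ler_wpM2l// AC.
Qed.

(** [B y] is the element [x] of [range A^*] for which [y - A x] is orthogonal
    to [range A].  It exists because [range A] and [range A^*] are closed; it is
    unique and bounded by a multiple of [|y|] because [A] is bounded below on
    [range A^*]. *)
Lemma moore_penrose_exists A : continuous A -> closed (range A) ->
  exists B : {linear K -> H}, is_moore_penrose A B.
Proof.
move=> Ac Aclosed.
have Rs := range_adjoint_subspace Ac.
have Rc := range_adjoint_closed Ac Aclosed.
have [C C0 AC] := bounded_below_range_adjoint Ac Aclosed.
pose P y x := range (adjoint A) x /\ orth_compl (range A) (y - A x).
have Pex y : exists x, P y x.
  have [_ [x0 _ <-] yx0] := ortho_decomp y (range_subspace A) Aclosed.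
  have [x Rx xo] := ortho_decomp x0 Rs Rc; exists x; split=> //.
  move/(kernel_adjoint _ Ac): xo; rewrite linearB => /eqP.
  by rewrite subr_eq0 => /eqP <-.
have [B0 B0P] := choice Pex.
have Puniq y x x' : P y x -> P y x' -> x = x'.
  move=> [Rx xo] [Rx' xo']; apply/subr0_eq/normr0_eq0/le_anti.
  rewrite normr_ge0 andbT (le_trans (AC _ _))//; first exact: subspaceB.
  suff -> : A (x - x') = 0 by rewrite normr0 mulr0.
  apply: (@ortho_self _ _ (range A)); first by exists (x - x').
  have -> : A (x - x') = (y - A x') - (y - A x).
    by rewrite linearB opprB [RHS]addrC addrA subrK.
  exact: orth_complB.
have B0l : linear B0.
  move=> a y y'; apply: (Puniq (a *: y + y')); first exact: B0P.
  have [Rx xo] := B0P y; have [Rx' xo'] := B0P y'; split; first exact: Rs.2.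
  move=> m Am; rewrite linearP opprD addrACA -scalerBr innerDl innerZl.
  by rewrite xo// xo'// mulr0 addr0.
pose B : {linear K -> H} := HB.pack B0 (GRing.isLinear.Build _ _ _ _ _ B0l).
have BP y : P y (B y) by exact: B0P.
have ABself y y' : '[A (B y), y'] = '[A (B y), A (B y')].
  apply/eqP; rewrite -subr_eq0 -innerBr; apply/eqP/inner_eq0C.
  by apply: (BP y').2; exists (B y).
have ABA x : A (B (A x)) = A x.
  apply/esym/subr0_eq/(@ortho_self _ _ (range A)); last exact: (BP _).2.
  by exists (x - B (A x)); rewrite ?linearB.
have BAself x x' : '[B (A x), x'] = '[B (A x), B (A x')].
  apply/eqP; rewrite -subr_eq0 -innerBr; apply/eqP/inner_eq0C.
  have /(kernel_adjoint _ Ac) : A (x' - B (A x')) = 0.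
    by rewrite linearB [X in _ - X]ABA subrr.
  apply; exact: (BP _).1.
exists B; split.
- apply/continuous_linearP; exists C => // y.
  rewrite (le_trans (AC _ (BP y).1))// ler_wpM2l ?(ltW C0)//.
  rewrite -(@ler_pXn2r _ 2) ?nnegrE//.
  have -> : `|y| ^+ 2 = `|(y - A (B y)) + A (B y)| ^+ 2 by rewrite subrK.
  rewrite normD_ortho ?lerDr ?exprn_ge0//.
  by apply: (BP y).2; exists (B y).
- apply: adjoint_eq => y y' /=.
  by rewrite ABself innerC -ABself -innerC.
- apply: adjoint_eq => x x' /=.
  by rewrite BAself innerC -BAself -innerC.
- by apply/funext => x /=; rewrite ABA.
- apply/funext => y /=; apply: (Puniq (A (B y))); first exact: BP.
  by split; [exact: (BP _).1|rewrite subrr => m _; rewrite inner0l].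
Qed.

(** The optimality property of the Moore-Penrose inverse: if [A u = y] has a
    solution, then [B y] is its only solution of least norm. *)
Lemma moore_penrose_least_norm A (B : {linear K -> H}) u :
  continuous A -> is_moore_penrose A B ->
  `|u| ^+ 2 = `|B (A u)| ^+ 2 + `|u - B (A u)| ^+ 2.
Proof.
move=> Ac [Bc _ BAs _ BAB].
have BAc : continuous (B \o A).
  by move=> x; apply: continuous_comp; [exact: Ac|exact: Bc].
have BAself x x' : '[B (A x), x'] = '[x, B (A x')].
  by rewrite (adjointP (A := B \o A) _ _ BAc) BAs.
have BABA x : B (A (B (A x))) = B (A x) by have := congr1 (@^~ (A x)) BAB.
have -> : `|u| ^+ 2 = `|u - B (A u) + B (A u)| ^+ 2 by rewrite subrK.
rewrite normD_ortho; first by rewrite addrC.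
by rewrite innerBl BAself BABA subrr.
Qed.

End ClosedRange.

(** [P_{A^*} x] and [x] have the same image under [A], so [A] maps the range of
    [P_{A^*} P_M] onto [A @` M]. *)
Lemma closed_image_proj (R : realType) (H K : hilbertType R)
    (A : {linear H -> K}) (M : set H) :
    continuous A -> closed (range A) -> is_subspace M -> closed M ->
    closed (range (orth_proj (range (adjoint A)) \o orth_proj M)) ->
  closed (A @` M).
Proof.
move=> Ac Aclosed Ms Mc Dc.
have Rs := range_adjoint_subspace Ac.
have RP x := orth_projP x Rs (range_adjoint_closed Ac Aclosed).
have AP x : A (orth_proj (range (adjoint A)) x) = A x.
  have /(kernel_adjoint _ Ac)/eqP := (RP x).2.
  by rewrite linearB subr_eq0 => /eqP.
have -> : A @` M =
    A @` range (orth_proj (range (adjoint A)) \o orth_proj M).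
  apply/seteqP; split=> [_ [x Mx <-]|_ [_ [x _ <-] <-]] /=.
    exists (orth_proj (range (adjoint A)) x); last exact: AP.
    by exists x; rewrite /= ?(orth_proj_id Ms Mc Mx).
  by exists (orth_proj M x); [exact: (orth_projP x Ms Mc).1|rewrite AP].
have [C C0 AC] := bounded_below_range_adjoint Ac Aclosed.
apply: (closed_image_bounded_below Ac Dc C0) => _ _ [x _ <-] [y _ <-].
by rewrite -linearB AC//; apply: subspaceB => //; exact: (RP _).1.
Qed.

(** * Square roots and operators on direct sums *)

(** A square root of an invertible operator is invertible: [Q^-1 = Q A^-1]. *)
Lemma inv_op_sqrt (R : realType) (K : hilbertType R) (A Q : {linear K -> K}) :
    continuous Q -> invertible_op A -> Q \o Q = A ->
  exists Q' : {linear K -> K},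
    [/\ continuous Q', inv_op Q = Q', cancel Q Q' & cancel Q' Q].
Proof.
move=> Qc [g gc [Ag gA]] QQ.
have QQE x : Q (Q x) = A x by rewrite -QQ.
have Qinj : injective Q.
  by move=> x y xy; apply: (can_inj Ag); rewrite -!QQE xy.
have Q'K : cancel (Q \o g) Q by move=> x /=; rewrite QQE gA.
exists (Q \o g); split=> //.
- by move=> x; apply: continuous_comp; [exact: gc|exact: Qc].
- apply/funext => y; apply: Qinj; rewrite Q'K.
  by apply: pinvK; rewrite inE; exists (Q (g y)) => //; exact: Q'K.
- by move=> x; apply: Qinj; rewrite Q'K.
Qed.

Section DirectSumOperators.
Context {R : realType} {K L : hilbertType R}.
Implicit Types u v : (K (+) L)%type.

Lemma dsum_innerE u v : '[u, v] = '[u.1, v.1] + '[u.2, v.2].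
Proof. by []. Qed.

Lemma dsum_normE u : `|u| ^+ 2 = `|u.1| ^+ 2 + `|u.2| ^+ 2.
Proof. by rewrite -!inner_normE. Qed.

Lemma dsum_op_linear (Q : {linear K -> K}) :
  linear (dsum_op Q (fun _ : L => 0 : L)).
Proof.
move=> a u v; rewrite /dsum_op /= linearP.
by congr pair; rewrite /= scaler0 addr0.
Qed.

Lemma dsum_op_continuous (Q : {linear K -> K}) :
  continuous Q -> continuous (dsum_op Q (fun _ : L => 0 : L)).
Proof.
pose F : {linear (K (+) L)%type -> (K (+) L)%type} :=
  HB.pack (dsum_op Q (fun _ : L => 0 : L))
    (GRing.isLinear.Build _ _ _ _ _ (dsum_op_linear Q)).
move=> /continuous_linearP[C C0 QC]; apply/(continuous_linearP F).
exists C => // u; have C0' := ltW C0.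
rewrite -(@ler_pXn2r _ 2) ?nnegrE ?mulr_ge0// exprMn !dsum_normE /=.
rewrite normr0 expr0n addr0 mulrDr ler_wpDr ?mulr_ge0 ?exprn_ge0//.
by rewrite -exprMn lerXn2r ?nnegrE ?mulr_ge0.
Qed.

End DirectSumOperators.

(** * The canonical form of [T] *)

Section CanonicalForm.
Context {R : realType} {H K L : hilbertType R}.
Context {U : {linear (K (+) L)%type -> H}}.
Context (U_cont : continuous U) (U_unitary : unitary_op U).
Local Notation V := (adjoint U).

Let UK u : V (U u) = u.
Proof. exact: (congr1 (@^~ u) U_unitary.1). Qed.

Let VK h : U (V h) = h.
Proof. exact: (congr1 (@^~ h) U_unitary.2). Qed.

Lemma unitary_innerV (g h : H) : '[g, h] = '[V g, V h].
Proof. by rewrite -adjointP// VK. Qed.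

Context {A1 : {linear K -> K}} {T : H -> H}.
Context (A1_inv : invertible_op A1)
  (TE : T = U \o dsum_op A1 (fun _ : L => 0 : L) \o V).

Lemma range_canonical : range T = [set h | (V h).2 = 0].
Proof.
rewrite TE; apply/seteqP; split=> [_ [h _ <-]|h /= h2].
  by rewrite /= UK.
have [g _ [_ gA]] := A1_inv; exists (U (g (V h).1, 0)) => //=.
by rewrite UK /dsum_op /= gA -h2 -[RHS]VK; congr (U _); case: (V h).
Qed.

Lemma orth_compl_kernel_canonical (x : H) :
  orth_compl (kernel T) x <-> (V x).2 = 0.
Proof.
split=> [xo|x2 m].
  have /xo : kernel T (U (0, (V x).2)).
    rewrite /kernel TE /= UK /dsum_op /= linear0.
    exact: (linear0 U).
  rewrite unitary_innerV UK dsum_innerE /= inner0r add0r; exact: inner_eq0.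
rewrite /kernel TE /= => Tm; rewrite unitary_innerV dsum_innerE x2 inner0l addr0.
have : dsum_op A1 (fun _ : L => 0 : L) (V m) = 0.
  by rewrite -[LHS]UK Tm -[RHS]UK linear0.
move=> /(congr1 fst) /= A1m; have [g _ [Ag _]] := A1_inv.
by rewrite -[(V m).1]Ag A1m linear0 inner0r.
Qed.

Lemma quadratic_canonical (R1 : {linear K -> K}) (x : H) :
    continuous R1 -> self_adjoint R1 -> R1 \o R1 = A1 ->
  '[x, T x] = `|R1 (V x).1| ^+ 2.
Proof.
move=> R1c R1s R1R1.
have R1C u v : '[R1 u, v] = '[u, R1 v] by rewrite adjointP// R1s.
rewrite TE unitary_innerV /= UK dsum_innerE /= inner0r addr0.
by rewrite -R1R1 /= -R1C inner_normE.
Qed.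

End CanonicalForm.

Theorem theorem3p8 (R : realType) (H : hilbertType R)
  (H_separable : separable H) (H_infinite : infinite_dimensional H)
  (T : {linear H -> H}) (T_bounded : continuous T)
  (T_singular : singular_op T) (T_positive : positive_op T)
  (T_closed : closed (range T))
  (K1 L1 : hilbertType R)
  (U1 : {linear (K1 (+) L1)%type -> H}) (U1_bounded : continuous U1)
  (U1_unitary : unitary_op U1)
  (A1 : {linear K1 -> K1}) (A1_bounded : continuous A1)
  (A1_iso : invertible_op A1)
  (T_canonical :
    (T : H -> H) = U1 \o dsum_op A1 (fun _ : L1 => 0 : L1) \o adjoint U1)
  (R1 : {linear K1 -> K1}) (R1_bounded : continuous R1)
  (R1_positive : positive_op R1) (R1_sqr : R1 \o R1 = A1)
  (A : {linear H -> H}) (A_bounded : continuous A)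
  (A_singular : singular_op A) (A_closed : closed (range A))
  (b : H)
  (S := [set x | orth_compl (kernel T) x /\ A x = b])
  (S_nonempty : S !=set0)
  (P_closed : closed (range
    (orth_proj (range (adjoint A)) \o orth_proj (range T))))
  (Rdag := dsum_op (inv_op R1) (fun _ : L1 => 0 : L1)) :
  exists2 B : {linear H -> (K1 (+) L1)%type},
    is_moore_penrose (A \o U1 \o Rdag) B &
    minimizers (fun x => '[x, T x]) S = [set U1 (Rdag (B b))].
Proof.
have [Q [Qc QE R1K QK]] := inv_op_sqrt R1_bounded A1_iso R1_sqr.
have UK u : adjoint U1 (U1 u) = u := congr1 (@^~ u) U1_unitary.1.
have VK h : U1 (adjoint U1 h) = h := congr1 (@^~ h) U1_unitary.2.
have SE x : S x <-> (adjoint U1 x).2 = 0 /\ A x = b.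
  by rewrite /S /= (orth_compl_kernel_canonical U1_bounded U1_unitary A1_iso
    T_canonical).
have qE x : '[x, T x] = `|R1 (adjoint U1 x).1| ^+ 2.
  exact: (quadratic_canonical U1_bounded U1_unitary T_canonical _ R1_bounded
    R1_positive.1 R1_sqr).
have RdagE u : Rdag u = (Q u.1, 0) by rewrite /Rdag QE.
pose RdagL : {linear (K1 (+) L1)%type -> (K1 (+) L1)%type} :=
  HB.pack (dsum_op Q (fun _ : L1 => 0 : L1))
    (GRing.isLinear.Build _ _ _ _ _ (dsum_op_linear Q)).
pose C := A \o U1 \o RdagL.
have CuE v : C v = A (U1 (Q v.1, 0)) by [].
have CE : A \o U1 \o Rdag = C by rewrite /Rdag QE.
have Cc : continuous C.
  move=> u; apply: continuous_comp; first exact: (dsum_op_continuous Qc).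
  by apply: continuous_comp; [exact: U1_bounded|exact: A_bounded].
have Cran : range C = A @` range T.
  rewrite (range_canonical U1_unitary A1_iso T_canonical).
  apply/seteqP; split=> [_ [u _ <-]|_ [h /= h2 <-]].
    by exists (U1 (Q u.1, 0)); rewrite /= ?UK.
  exists (R1 (adjoint U1 h).1, 0) => //.
  rewrite CuE /= R1K; congr (A _); rewrite -[RHS]VK -h2.
  by congr (U1 _); case: (adjoint U1 h).
have Cclosed : closed (range C).
  rewrite Cran.
  apply: closed_image_proj A_closed _ T_closed P_closed => //.
  exact: range_subspace.
have [B BP] := moore_penrose_exists Cc Cclosed.
exists B; first by rewrite CE.
(* Up to the unitary [U1], [u x] is the square root of [T] applied to [x]. *)
pose u x : (K1 (+) L1)%type := (R1 (adjoint U1 x).1, 0).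
have Cu x : S x -> C (u x) = b.
  move=> /SE[x2 <-]; rewrite CuE /= R1K; congr (A _); rewrite -[RHS]VK -x2.
  by congr (U1 _); case: (adjoint U1 x).
have qu x : '[x, T x] = `|u x| ^+ 2.
  by rewrite qE dsum_normE /= normr0 expr0n addr0.
have split_u x : S x -> `|u x| ^+ 2 = `|B b| ^+ 2 + `|u x - B b| ^+ 2.
  by move=> /Cu <-; exact: moore_penrose_least_norm.
set xhat := U1 (Rdag (B b)).
have Sxhat : S xhat.
  have [x0 /Cu x0b] := S_nonempty; have [_ _ _ CBC _] := BP.
  have CBb : C (B b) = b by rewrite -x0b; exact: (congr1 (@^~ (u x0)) CBC).
  by apply/SE; rewrite /xhat RdagE UK.
(* The second component of [B b] does not enter [xhat]; an inequality is enough,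
   so there is no need to check that this component vanishes. *)
have qxhat : '[xhat, T xhat] <= `|B b| ^+ 2.
  by rewrite qE /xhat RdagE UK /= QK dsum_normE lerDl exprn_ge0.
apply/seteqP; split=> [x [Sx xmin]|_ ->]; last first.
  by split=> // y Sy; rewrite (le_trans qxhat)// qu split_u// lerDl exprn_ge0.
have := le_trans (xmin _ Sxhat) qxhat.
rewrite qu split_u// gerDl => le0.
have /subr0_eq uB : u x - B b = 0.
  by apply/eqP; rewrite -normr_eq0 -sqrf_eq0 eq_le le0 exprn_ge0.
rewrite /xhat -uB RdagE /u /= R1K -[LHS]VK.
have [x2 _] := (SE x).1 Sx.
by rewrite -x2; congr (U1 _); case: (adjoint U1 x).
Qed.
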